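(* For every positive integer $\ell$ and $|q|<1$, $$\frac{(-q;q^2)_\infty}{(q^2;q^2)_\infty}\sum_{j=-\ell+1}^{\ell}(-1)^jq^{2j^2+j}=1+(-1)^{\ell-1}\sum_{n=0}^\infty\frac{(-q;q^2)_{n+\ell}\,q^{2\ell n+n^2+2\ell^2-\ell}(1-q^{2\ell})}{(q^2;q^2)_n(q^2;q^2)_{n+2\ell}(1-q^{2n+2\ell})}.$$
   Context: $(a;p)_n=\prod_{m=0}^{n-1}(1-ap^m)$ with $(a;p)_0=1$, and $(a;p)_\infty=\prod_{m\ge0}(1-ap^m)$. *)

(* Defs.v *)
From Stdlib Require Import Reals ZArith Lra Lia.
From Coquelicot Require Import Coquelicot.
Open Scope C_scope.

Notation C := Complex.C.

(** The complex analogue of [powerRZ]; note that [Cpowz 0 0 = 1]. *)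
Definition Cpowz (z : C) (k : Z) : C :=
  match k with
  | Z0 => 1
  | Zpos m => z ^ Pos.to_nat m
  | Zneg m => / z ^ Pos.to_nat m
  end.

Fixpoint qpoch (a p : C) (n : nat) : C :=
  match n with
  | O => 1
  | S m => qpoch a p m * (1 - a * p ^ m)
  end.

(** [iota P] is the element satisfying [P] when it exists and is unique;
    [qpoch_inf_correct] below shows that this is the case here as soon as
    [Cmod p < 1]. *)
Definition qpoch_inf (a p : C) : C :=
  @iota C_CompleteNormedModule
    (fun L : C => filterlim (qpoch a p) eventually (locally L)).

Lemma qpoch_bound (a p : C) (hp : (Cmod p < 1)%R) (n : nat) :
  (Cmod (qpoch a p n) <= exp (Cmod a * ((1 - Cmod p ^ n) / (1 - Cmod p))))%R.
Proof.
induction n as [|n IH].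
- cbn [qpoch pow]. rewrite Cmod_1. unfold Rdiv.
  rewrite Rminus_diag, Rmult_0_l, Rmult_0_r, exp_0. apply Rle_refl.
- cbn [qpoch]. rewrite Cmod_mult.
  replace (Cmod a * ((1 - Cmod p ^ S n) / (1 - Cmod p)))%R
    with (Cmod a * ((1 - Cmod p ^ n) / (1 - Cmod p)) + Cmod a * Cmod p ^ n)%R
    by (cbn [pow]; field; lra).
  rewrite exp_plus.
  apply Rmult_le_compat; try apply Cmod_ge_0; trivial.
  assert (H : (Cmod (1 - a * p ^ n) <= 1 + Cmod a * Cmod p ^ n)%R).
  { unfold Cminus. eapply Rle_trans; [apply Cmod_triangle|].
    rewrite Cmod_1, Cmod_opp, Cmod_mult, Cmod_pow. apply Rle_refl. }
  eapply Rle_trans; [exact H|]. apply exp_ineq1_le.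
Qed.

Lemma exp_mono_le (x y : R) : (x <= y)%R -> (exp x <= exp y)%R.
Proof.
intros [H|H]; [left; apply exp_increasing, H | right; now rewrite H].
Qed.

Lemma qpoch_ex_lim (a p : C) (hp : (Cmod p < 1)%R) :
  exists L : C, filterlim (qpoch a p) eventually (locally L).
Proof.
pose (d := fun n : nat => qpoch a p (S n) - qpoch a p n).
pose (M := exp (Cmod a * / (1 - Cmod p))).
assert (Hd : @ex_series C_AbsRing C_CompleteNormedModule d).
{ apply (@ex_series_le C_AbsRing C_CompleteNormedModule d
           (fun n => (M * Cmod a) * Cmod p ^ n)%R).
  - intros n. change (Cmod (d n) <= M * Cmod a * Cmod p ^ n)%R.
    replace (d n) with (- (qpoch a p n * (a * p ^ n)))
      by (unfold d; cbn [qpoch]; ring).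
    rewrite Cmod_opp, !Cmod_mult, Cmod_pow, Rmult_assoc.
    apply Rmult_le_compat_r.
    { apply Rmult_le_pos; [apply Cmod_ge_0|apply pow_le, Cmod_ge_0]. }
    eapply Rle_trans; [apply qpoch_bound, hp|].
    apply exp_mono_le. apply Rmult_le_compat_l; [apply Cmod_ge_0|].
    unfold Rdiv. rewrite <- (Rmult_1_l (/ _)) at 2.
    apply Rmult_le_compat_r.
    { apply Rlt_le, Rinv_0_lt_compat. lra. }
    assert (0 <= Cmod p ^ n)%R by apply pow_le, Cmod_ge_0. lra.
  - apply (@ex_series_scal_l R_AbsRing). apply ex_series_geom.
    rewrite Rabs_pos_eq; [exact hp|apply Cmod_ge_0]. }
destruct Hd as [L HL].
assert (Hsum : forall n, @sum_n C_AbelianMonoid d n = qpoch a p (S n) - 1).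
{ induction n as [|n IH].
  - rewrite sum_O. unfold d. simpl. ring.
  - rewrite sum_Sn, IH. unfold d.
    change (qpoch a p (S n) - 1 + (qpoch a p (S (S n)) - qpoch a p (S n))
            = qpoch a p (S (S n)) - 1). ring. }
exists (1 + L).
assert (HS : filterlim (fun n => qpoch a p (S n)) eventually
               (@locally C_NormedModule (1 + L))).
{ apply (filterlim_ext (fun n => @plus C_AbelianMonoid (RtoC 1) (sum_n d n))).
  - intros n. rewrite Hsum. change (1 + (qpoch a p (S n) - 1) = qpoch a p (S n)).
    ring.
  - apply (@filterlim_comp_2 nat C C C eventually
             (@locally C_NormedModule (RtoC 1)) (@locally C_NormedModule L)
             _ _ (fun _ => RtoC 1) (@sum_n C_AbelianMonoid d)
             (@plus C_AbelianMonoid)).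
    + apply (@filterlim_const nat C_NormedModule eventually _ (RtoC 1)).
    + exact HL.
    + apply (@filterlim_plus C_AbsRing C_NormedModule). }
intros P HP. destruct (HS P HP) as [N HN]. exists (S N).
intros [|n] Hn; [lia|]. apply HN. lia.
Qed.

Lemma qpoch_inf_correct (a p : C) (hp : (Cmod p < 1)%R) :
  filterlim (qpoch a p) eventually (locally (qpoch_inf a p)).
Proof.
destruct (qpoch_ex_lim a p hp) as [L HL].
assert (E : qpoch_inf a p = L).
{ apply (@iota_filterlim_locally C_AbsRing C_CompleteNormedModule); [|exact HL].
  apply Proper_StrongProper, eventually_filter. }
rewrite E. exact HL.
Qed.

(* Main.v *)
Require Import Defs.
From Stdlib Require Import Reals ZArith Lra Lia.
From Coquelicot Require Import Coquelicot.
Open Scope C_scope.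

(** Write [p = q^2], let [Q = (-q;p)_oo / (p;p)_oo], let [E_l] be the truncated
    theta sum and let [T_l] be the series on the right.  The identity is
    [Q E_l = 1 - (-1)^l T_l], and it is proved by induction on [l].

    Put [N = n + l] in the summand; up to the factor [q^(l^2-l)] it becomes
    [(1-p^l) (-q;p)_N q^(N^2) / ((p;p)_(N-l) (p;p)_(N+l) (1-p^N))].  In this
    form the summands for [l] and [l+1] combine at equal [N], and the factor
    [1-p^N] in the denominator cancels ([pair_term_S]).  What remains is a
    series that splits into two instances of the limiting q-Gauss sum
    [sum_n (a;p)_n (-b)^n p^(n(n-1)/2) / ((p;p)_n (ab;p)_n) = (b;p)_oo / (ab;p)_oo]
    ([gauss_sum]), which gives [pair_sum]:
    [T_l + T_(l+1) = Q q^(2l^2-l) (1 - q^(6l+3))].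
    Up to the sign [(-1)^l] the right side is [Q] times the two theta terms
    [j = -l] and [j = l+1] by which [E_(l+1)] exceeds [E_l] ([theta_trunc_S]).

    The induction starts at [l = 0]: [E_0] is an empty sum, and in [T_0] only
    the term [n = 0] survives, a removable singularity of value 1.

    The q-Gauss sum itself comes from a contiguous relation between its terms
    at [b] and at [b p] ([gauss_term_shift]); iterating it drives [b p^m] to 0,
    where the sum is 1, by a geometric bound uniform in [m]. *)

(** * Complex sequences and series *)

Definition Cseries (a : nat -> C) (A : C) : Prop :=
  @is_series C_AbsRing C_NormedModule a A.

Definition Clim (u : nat -> C) (L : C) : Prop :=
  is_lim_seq (fun n => Cmod (u n - L)) 0.

(** Coquelicot equips the complex plane with the sup-norm balls of the product
    of two lines; the modulus is more convenient for estimates. *)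
Lemma Clim_filterlim (u : nat -> C) (L : C) :
  @filterlim nat C u eventually (@locally C_NormedModule L) <-> Clim u L.
Proof.
rewrite (@filterlim_locally_ball_norm C_AbsRing nat C_NormedModule eventually
           (@filter_filter' _ _ (Proper_StrongProper _ eventually_filter))).
unfold Clim. rewrite <- is_lim_seq_spec. unfold is_lim_seq'.
split; intros H eps; specialize (H eps); revert H; apply filter_imp; intros n H.
- rewrite Rminus_0_r, Rabs_pos_eq; [exact H | apply Cmod_ge_0].
- rewrite Rminus_0_r, Rabs_pos_eq in H; [exact H | apply Cmod_ge_0].
Qed.

Lemma Clim_unique (u : nat -> C) (L M : C) : Clim u L -> Clim u M -> L = M.
Proof.
intros HL HM. apply Clim_filterlim in HL, HM.
exact (@filterlim_locally_unique nat C_AbsRing C_NormedModule eventually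
         (Proper_StrongProper _ eventually_filter) u L M HL HM).
Qed.

Lemma Clim_of_bound (u : nat -> C) (L : C) (b : nat -> R) :
  (forall n, Cmod (u n - L) <= b n)%R -> is_lim_seq b 0 -> Clim u L.
Proof.
intros H Hb.
apply (is_lim_seq_le_le (fun _ => 0%R) _ b); [|apply is_lim_seq_const|exact Hb].
intros n. split; [apply Cmod_ge_0 | apply H].
Qed.

Lemma Clim_const (c : C) : Clim (fun _ => c) c.
Proof.
apply (Clim_of_bound _ _ (fun _ => 0%R)); [|apply is_lim_seq_const].
intros n. unfold Cminus. rewrite Cplus_opp_r, Cmod_0. apply Rle_refl.
Qed.

Lemma Clim_ext (u v : nat -> C) (L : C) :
  (forall n, u n = v n) -> Clim u L -> Clim v L.
Proof.
intros E. apply is_lim_seq_ext. intros n. now rewrite E.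
Qed.

Lemma Clim_mult (u v : nat -> C) (U V : C) :
  Clim u U -> Clim v V -> Clim (fun n => u n * v n) (U * V).
Proof.
intros HU HV.
apply (Clim_of_bound _ _
  (fun n => Cmod (u n - U) * Cmod (v n - V)
            + (Cmod U * Cmod (v n - V) + Cmod V * Cmod (u n - U)))%R).
- intros n.
  replace (u n * v n - U * V)
    with ((u n - U) * (v n - V) + (U * (v n - V) + V * (u n - U))) by ring.
  rewrite <- !Cmod_mult.
  eapply Rle_trans; [apply Cmod_triangle|]. apply Rplus_le_compat_l, Cmod_triangle.
- replace 0%R with (0 * 0 + (Cmod U * 0 + Cmod V * 0))%R by ring.
  apply is_lim_seq_plus'; [now apply is_lim_seq_mult'|].
  apply is_lim_seq_plus'; (apply is_lim_seq_mult'; [apply is_lim_seq_const|assumption]).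
Qed.

Lemma Clim_shift (u : nat -> C) (k : nat) (L : C) :
  Clim u L -> Clim (fun n => u (n + k)%nat) L.
Proof. intros H. exact (proj1 (is_lim_seq_incr_n _ k _) H). Qed.

Lemma is_lim_seq_Cmod_pow (p : C) (K : R) :
  (Cmod p < 1)%R -> is_lim_seq (fun n => K * Cmod p ^ n)%R 0.
Proof.
intros hp. replace 0%R with (K * 0)%R by ring.
apply is_lim_seq_mult'; [apply is_lim_seq_const|].
apply is_lim_seq_geom. rewrite Rabs_pos_eq; [exact hp | apply Cmod_ge_0].
Qed.

Lemma Cmod_pow_le_1 (p : C) (n : nat) : (Cmod p <= 1)%R -> (Cmod (p ^ n) <= 1)%R.
Proof.
intros hp. rewrite Cmod_pow, <- (pow1 n). apply pow_incr.
split; [apply Cmod_ge_0 | exact hp].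
Qed.

Lemma Rmult_le_l (x y : R) : (0 <= x)%R -> (y <= 1)%R -> (x * y <= x)%R.
Proof.
intros hx hy. rewrite <- (Rmult_1_r x) at 2. now apply Rmult_le_compat_l.
Qed.

Lemma Cmod_mult_lt_1 (z w : C) :
  (Cmod z < 1)%R -> (Cmod w <= 1)%R -> (Cmod (z * w) < 1)%R.
Proof.
intros hz hw. rewrite Cmod_mult.
eapply Rle_lt_trans; [apply Rmult_le_l|]; [apply Cmod_ge_0 | exact hw | exact hz].
Qed.

Lemma one_minus_neq_0 (z : C) : (Cmod z < 1)%R -> 1 - z <> 0.
Proof.
intros Hz E. assert (z = 1) as -> by (rewrite <- (Cplus_0_r z), <- E; ring).
rewrite Cmod_1 in Hz. lra.
Qed.

Lemma Cseries_plus (a b : nat -> C) (A B : C) :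
  Cseries a A -> Cseries b B -> Cseries (fun n => a n + b n) (A + B).
Proof. apply (@is_series_plus C_AbsRing C_NormedModule). Qed.

Lemma Cseries_scal (c : C) (a : nat -> C) (A : C) :
  Cseries a A -> Cseries (fun n => c * a n) (c * A).
Proof. apply (@is_series_scal C_AbsRing C_NormedModule). Qed.

Lemma Cseries_tail (a : nat -> C) (A : C) :
  Cseries a A -> Cseries (fun n => a (S n)) (A - a O).
Proof.
intros H. apply (@is_series_incr_1 C_AbsRing C_NormedModule).
change (Cseries a (A - a O + a O)). replace (A - a O + a O) with A by ring. exact H.
Qed.

Lemma Cseries_cons (a : nat -> C) (A : C) :
  Cseries (fun n => a (S n)) (A - a O) -> Cseries a A.
Proof. intros H. apply (@is_series_decr_1 C_AbsRing C_NormedModule). exact H. Qed.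

Lemma Cseries_ext (a b : nat -> C) (A : C) :
  (forall n, a n = b n) -> Cseries a A -> Cseries b A.
Proof. apply (@is_series_ext C_AbsRing C_NormedModule). Qed.

Lemma Cseries_unique (a : nat -> C) (A B : C) : Cseries a A -> Cseries a B -> A = B.
Proof.
intros HA HB. apply (Clim_unique (@sum_n C_AbelianMonoid a));
  apply Clim_filterlim; assumption.
Qed.

Lemma Cseries_ex_of_geom (a : nat -> C) (K r : R) :
  (0 <= r < 1)%R -> (forall n, Cmod (a n) <= K * r ^ n)%R -> exists A, Cseries a A.
Proof.
intros Hr H.
apply (@ex_series_le C_AbsRing C_CompleteNormedModule a (fun n => K * r ^ n)%R).
- exact H.
- apply (@ex_series_scal_l R_AbsRing), ex_series_geom. rewrite Rabs_pos_eq; lra.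
Qed.

Lemma Cseries_bound_geom (a : nat -> C) (A : C) (K r : R) :
  (0 <= r < 1)%R -> (forall n, Cmod (a n) <= K * r ^ n)%R -> Cseries a A ->
  (Cmod A <= K / (1 - r))%R.
Proof.
intros Hr H HA. apply Clim_filterlim in HA.
assert (HK : (0 <= K)%R).
{ specialize (H O). cbn in H. pose proof (Cmod_ge_0 (a O)). lra. }
assert (Hs : forall n, (Cmod (@sum_n C_AbelianMonoid a n)
                        <= K * ((1 - r ^ S n) / (1 - r)))%R).
{ induction n as [|n IH].
  - rewrite sum_O. eapply Rle_trans; [apply H|]. right. simpl. field. lra.
  - rewrite sum_Sn. eapply Rle_trans; [apply Cmod_triangle|].
    eapply Rle_trans; [apply Rplus_le_compat; [exact IH | apply H]|].
    right. simpl. field. lra. }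
assert (Hn : forall n, (Cmod A - K / (1 - r)
                        <= Cmod (@sum_n C_AbelianMonoid a n - A))%R).
{ intros n.
  assert (T : (Cmod A <= Cmod (@sum_n C_AbelianMonoid a n)
               + Cmod (@sum_n C_AbelianMonoid a n - A))%R).
  { rewrite <- (Cmod_opp (_ - _)). eapply Rle_trans; [|apply Cmod_triangle].
    right. f_equal. ring. }
  assert (HL : (K * ((1 - r ^ S n) / (1 - r)) <= K / (1 - r))%R).
  { unfold Rdiv. apply Rmult_le_compat_l; [exact HK|].
    rewrite <- (Rmult_1_l (/ _)) at 2. apply Rmult_le_compat_r.
    - apply Rlt_le, Rinv_0_lt_compat. lra.
    - assert (0 <= r ^ S n)%R by (apply pow_le; lra). lra. }
  specialize (Hs n). lra. }
pose proof (is_lim_seq_le _ _ _ _ Hn (is_lim_seq_const _) HA) as HF.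
simpl in HF. lra.
Qed.

(** * q-Pochhammer symbols *)

Lemma qpoch_add (a p : C) (m n : nat) :
  qpoch a p (m + n) = qpoch a p m * qpoch (a * p ^ m) p n.
Proof.
induction n as [|n IH].
- rewrite Nat.add_0_r. cbn. ring.
- rewrite Nat.add_succ_r. cbn [qpoch]. rewrite IH, Cpow_add_r. ring.
Qed.

Lemma qpoch_head (a p : C) (n : nat) :
  qpoch a p (S n) = (1 - a) * qpoch (a * p) p n.
Proof.
change (S n) with (1 + n)%nat. rewrite qpoch_add, Cpow_1_r. cbn. ring.
Qed.

Lemma qpoch_upper (a p : C) (n : nat) : (Cmod p < 1)%R ->
  (Cmod (qpoch a p n) <= exp (Cmod a / (1 - Cmod p)))%R.
Proof.
intros hp. eapply Rle_trans; [apply qpoch_bound, hp|].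
apply exp_mono_le, Rmult_le_compat_l; [apply Cmod_ge_0|].
unfold Rdiv. rewrite <- (Rmult_1_l (/ (1 - _))) at 2.
apply Rmult_le_compat_r.
- apply Rlt_le, Rinv_0_lt_compat. lra.
- assert (0 <= Cmod p ^ n)%R by apply pow_le, Cmod_ge_0. lra.
Qed.

(** Uniformly in [n], and in [a] on each disc of radius less than 1, a
    q-Pochhammer symbol stays away from 0.  Factor by factor this is
    [1 / (1 - y) = 1 + y / (1 - y) <= exp (y / (1 - rho))] for [y <= rho]. *)
Lemma qpoch_lower (a p : C) (rho : R) (n : nat) :
  (Cmod p < 1)%R -> (Cmod a <= rho < 1)%R ->
  (exp (- (rho / (1 - rho) / (1 - Cmod p))) <= Cmod (qpoch a p n))%R.
Proof.
intros hp [Ha Hrho]. pose proof (Cmod_ge_0 a) as Ha0. pose proof (Cmod_ge_0 p) as Hp0.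
set (k := (rho / (1 - rho))%R).
assert (Hk : (0 <= k)%R).
{ apply Rmult_le_pos; [lra | apply Rlt_le, Rinv_0_lt_compat; lra]. }
assert (Hn : (exp (- (k * ((1 - Cmod p ^ n) / (1 - Cmod p)))) <= Cmod (qpoch a p n))%R).
{ induction n as [|n IH].
  - cbn. rewrite Cmod_1. unfold Rdiv.
    rewrite Rminus_diag, Rmult_0_l, Rmult_0_r, Ropp_0, exp_0. apply Rle_refl.
  - cbn [qpoch]. rewrite Cmod_mult.
    replace (- (k * ((1 - Cmod p ^ S n) / (1 - Cmod p))))%R
      with (- (k * ((1 - Cmod p ^ n) / (1 - Cmod p))) + - (k * Cmod p ^ n))%R
      by (cbn [pow]; field; lra).
    rewrite exp_plus.
    apply Rmult_le_compat; try (apply Rlt_le, exp_pos); [exact IH|].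
    assert (Hr0 : (0 <= Cmod p ^ n)%R) by apply pow_le, Cmod_ge_0.
    assert (Hr1 : (Cmod p ^ n <= 1)%R).
    { rewrite <- Cmod_pow. apply Cmod_pow_le_1. lra. }
    set (r := (Cmod p ^ n)%R) in *.
    assert (T : (1 - rho * r <= Cmod (1 - a * p ^ n))%R).
    { assert (T1 : (1 <= Cmod (1 - a * p ^ n) + Cmod a * r)%R).
      { unfold r. rewrite <- Cmod_pow, <- Cmod_mult.
        eapply Rle_trans; [|apply Cmod_triangle]. right.
        rewrite <- Cmod_1 at 1. f_equal. ring. }
      assert (Cmod a * r <= rho * r)%R by (apply Rmult_le_compat_r; lra). lra. }
    eapply Rle_trans; [|exact T]. rewrite exp_Ropp.
    assert (He : (1 + k * r <= exp (k * r))%R) by apply exp_ineq1_le.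
    assert (Hkr : (0 <= k * r)%R) by (apply Rmult_le_pos; lra).
    assert (H1 : (1 <= (1 - rho * r) * (1 + k * r))%R).
    { replace ((1 - rho * r) * (1 + k * r))%R
        with (1 + r * rho * (rho / (1 - rho)) * (1 - r))%R
        by (unfold k; field; lra).
      assert (0 <= r * rho * (rho / (1 - rho)) * (1 - r))%R.
      { apply Rmult_le_pos; [|lra]. apply Rmult_le_pos; [|exact Hk].
        apply Rmult_le_pos; lra. }
      lra. }
    assert (Hpos : (0 <= 1 - rho * r)%R).
    { assert (rho * r <= rho * 1)%R by (apply Rmult_le_compat_l; lra). lra. }
    assert (H2 : (1 <= (1 - rho * r) * exp (k * r))%R).
    { eapply Rle_trans; [exact H1|]. apply Rmult_le_compat_l; assumption. }
    apply (Rmult_le_reg_r (exp (k * r))); [apply exp_pos|].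
    rewrite Rinv_l; [exact H2|]. apply Rgt_not_eq, exp_pos. }
eapply Rle_trans; [|exact Hn]. apply exp_mono_le, Ropp_le_contravar.
apply Rmult_le_compat_l; [exact Hk|].
unfold Rdiv. rewrite <- (Rmult_1_l (/ (1 - Cmod p))) at 2.
apply Rmult_le_compat_r.
- apply Rlt_le, Rinv_0_lt_compat. lra.
- assert (0 <= Cmod p ^ n)%R by apply pow_le, Cmod_ge_0. lra.
Qed.

Lemma qpoch_neq_0 (a p : C) (n : nat) :
  (Cmod p < 1)%R -> (Cmod a < 1)%R -> qpoch a p n <> 0.
Proof.
intros hp ha. apply Cmod_gt_0. eapply Rlt_le_trans; [apply exp_pos|].
apply (qpoch_lower a p (Cmod a) n hp). lra.
Qed.

Lemma qpoch_Clim (a p : C) : (Cmod p < 1)%R -> Clim (qpoch a p) (qpoch_inf a p).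
Proof. intros hp. apply Clim_filterlim, qpoch_inf_correct, hp. Qed.

Lemma qpoch_inf_split (a p : C) (m : nat) : (Cmod p < 1)%R ->
  qpoch_inf a p = qpoch a p m * qpoch_inf (a * p ^ m) p.
Proof.
intros hp. apply (Clim_unique (fun n => qpoch a p (n + m))).
- apply Clim_shift, qpoch_Clim, hp.
- apply (Clim_ext (fun n => qpoch a p m * qpoch (a * p ^ m) p n)).
  + intros n. rewrite Nat.add_comm. symmetry. apply qpoch_add.
  + apply Clim_mult; [apply Clim_const | apply qpoch_Clim, hp].
Qed.

Lemma qpoch_inf_neq_0 (a p : C) :
  (Cmod p < 1)%R -> (Cmod a < 1)%R -> qpoch_inf a p <> 0.
Proof.
intros hp ha E. pose proof (qpoch_Clim a p hp) as H. rewrite E in H.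
assert (Hle : forall n, (exp (- (Cmod a / (1 - Cmod a) / (1 - Cmod p)))
                         <= Cmod (qpoch a p n - 0))%R).
{ intros n. replace (qpoch a p n - 0) with (qpoch a p n) by ring.
  apply (qpoch_lower a p (Cmod a) n hp). lra. }
pose proof (is_lim_seq_le _ _ _ _ Hle (is_lim_seq_const _) H) as HF. simpl in HF.
pose proof (exp_pos (- (Cmod a / (1 - Cmod a) / (1 - Cmod p)))). lra.
Qed.

(** * The limiting q-Gauss sum *)

Definition gauss_term (a b p : C) (n : nat) : C :=
  qpoch a p n * (- b) ^ n * p ^ (n * (n - 1) / 2) / (qpoch p p n * qpoch (a * b) p n).

Lemma triangular_S (n : nat) : (S n * (S n - 1) / 2 = n * (n - 1) / 2 + n)%nat.
Proof.
rewrite <- Nat.div_add by lia. f_equal. destruct n; simpl; lia.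
Qed.

Lemma triangular_double (n : nat) : (2 * (n * (n - 1) / 2) + n = n ^ 2)%nat.
Proof.
induction n as [|n IH]; [reflexivity|]. rewrite triangular_S. simpl in *. lia.
Qed.

(** The constant does not depend on [b] as long as [a * b] stays in one disc, so
    it serves all the parameters [b * p ^ m] at once. *)
Lemma gauss_term_bound (a p : C) (rho : R) : (Cmod p < 1)%R -> (rho < 1)%R ->
  exists K, (0 <= K)%R /\ forall b n, (Cmod (a * b) <= rho)%R ->
    (Cmod (gauss_term a b p n) <= K * Cmod b ^ n)%R.
Proof.
intros hp hrho. pose proof (Cmod_ge_0 p) as Hp0.
set (A := exp (Cmod a / (1 - Cmod p))).
set (D1 := exp (- (Cmod p / (1 - Cmod p) / (1 - Cmod p)))).
set (D2 := exp (- (rho / (1 - rho) / (1 - Cmod p)))).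
assert (HA : (0 < A)%R) by apply exp_pos.
assert (HD1 : (0 < D1)%R) by apply exp_pos.
assert (HD2 : (0 < D2)%R) by apply exp_pos.
exists (A * / (D1 * D2))%R. split.
{ apply Rmult_le_pos; [lra | apply Rlt_le, Rinv_0_lt_compat, Rmult_lt_0_compat; lra]. }
intros b n Hb.
assert (H1 : (D1 <= Cmod (qpoch p p n))%R) by (apply qpoch_lower; lra).
assert (H2 : (D2 <= Cmod (qpoch (a * b) p n))%R) by (apply qpoch_lower; lra).
unfold gauss_term.
rewrite Cmod_div.
2: { apply Cmult_neq_0; apply qpoch_neq_0; lra. }
rewrite !Cmod_mult, (Cmod_pow (- b)), Cmod_opp.
replace (A * / (D1 * D2) * Cmod b ^ n)%R
  with ((A * Cmod b ^ n * 1) * / (D1 * D2))%R by ring.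
assert (Hb0 : (0 <= Cmod b ^ n)%R) by apply pow_le, Cmod_ge_0.
apply Rmult_le_compat.
- repeat apply Rmult_le_pos; try apply Cmod_ge_0. exact Hb0.
- apply Rlt_le, Rinv_0_lt_compat, Rmult_lt_0_compat; lra.
- apply Rmult_le_compat.
  + apply Rmult_le_pos; [apply Cmod_ge_0 | exact Hb0].
  + apply Cmod_ge_0.
  + apply Rmult_le_compat_r; [exact Hb0 | apply qpoch_upper, hp].
  + apply Cmod_pow_le_1. lra.
- apply Rinv_le_contravar; [apply Rmult_lt_0_compat; lra|].
  apply Rmult_le_compat; lra.
Qed.

(** Summing over [n], the second part of the right side is an index shift of
    [(1 - p^n) * gauss_term a b p n], whose term at [n = 0] vanishes, so the two
    parts recombine to the sum at [b]. *)
Lemma gauss_term_shift (a b p : C) (n : nat) :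
  (Cmod p < 1)%R -> (Cmod (a * b) < 1)%R ->
  (1 - b) * gauss_term a (b * p) p n
  = (1 - a * b) * (p ^ n * gauss_term a b p n
                   + (1 - p ^ S n) * gauss_term a b p (S n)).
Proof.
intros hp hab. unfold gauss_term.
assert (Hab' : (Cmod (a * b * p) < 1)%R).
{ apply Cmod_mult_lt_1; [exact hab | lra]. }
assert (Hpn : (Cmod (p ^ n) <= 1)%R) by (apply Cmod_pow_le_1; lra).
assert (E : (1 - a * b) * qpoch (a * b * p) p n
            = qpoch (a * b) p n * (1 - a * b * p ^ n)).
{ rewrite <- qpoch_head. reflexivity. }
rewrite triangular_S, Cpow_add_r.
replace ((- (b * p)) ^ n) with ((- b) ^ n * p ^ n)
  by (rewrite <- Cpow_mult_l; f_equal; ring).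
cbn [qpoch]. rewrite !Cpow_S, !(Cmult_assoc a b p).
assert (N1 : 1 - a * b <> 0) by (apply one_minus_neq_0; exact hab).
assert (N2 : 1 - a * b * p ^ n <> 0).
{ apply one_minus_neq_0, Cmod_mult_lt_1; assumption. }
assert (N3 : 1 - p * p ^ n <> 0).
{ apply one_minus_neq_0, Cmod_mult_lt_1; assumption. }
assert (N4 : qpoch p p n <> 0) by (apply qpoch_neq_0; assumption).
assert (N5 : qpoch (a * b) p n <> 0) by (apply qpoch_neq_0; assumption).
assert (E' : qpoch (a * b * p) p n
             = qpoch (a * b) p n * (1 - a * b * p ^ n) / (1 - a * b)).
{ rewrite <- E. field. exact N1. }
rewrite E'. field. repeat split; assumption.
Qed.

Lemma gauss_sum_shift (a b p F G : C) :
  (Cmod p < 1)%R -> (Cmod b < 1)%R -> (Cmod (a * b) < 1)%R ->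
  Cseries (gauss_term a b p) F -> Cseries (gauss_term a (b * p) p) G ->
  (1 - b) * G = (1 - a * b) * F.
Proof.
intros hp hb hab HF HG. pose proof (Cmod_ge_0 b) as Hb0.
destruct (gauss_term_bound a p (Cmod (a * b)) hp hab) as [K [HK HKb]].
destruct (Cseries_ex_of_geom (fun n => p ^ n * gauss_term a b p n) K (Cmod b))
  as [X HX].
{ lra. }
{ intros n. rewrite Cmod_mult, <- (Rmult_1_l (K * _)).
  apply Rmult_le_compat; try apply Cmod_ge_0.
  - apply Cmod_pow_le_1. lra.
  - apply HKb. lra. }
apply (Cseries_unique (fun n => (1 - b) * gauss_term a (b * p) p n)).
{ apply Cseries_scal, HG. }
apply (Cseries_ext (fun n => (1 - a * b) * (p ^ n * gauss_term a b p n
                     + (1 - p ^ S n) * gauss_term a b p (S n)))).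
{ intros n. symmetry. apply gauss_term_shift; assumption. }
apply Cseries_scal.
replace F with (X + (F - X)) by ring. apply Cseries_plus; [exact HX|].
assert (HU : Cseries (fun n => (1 - p ^ n) * gauss_term a b p n) (F - X)).
{ apply (Cseries_ext (fun n => gauss_term a b p n
                               + (- (1)) * (p ^ n * gauss_term a b p n))).
  - intros n. ring.
  - replace (F - X) with (F + (- (1)) * X) by ring.
    apply Cseries_plus; [exact HF | apply Cseries_scal, HX]. }
apply Cseries_tail in HU. cbn [Cpow] in HU.
replace (F - X - (1 - 1) * gauss_term a b p 0) with (F - X) in HU by ring.
exact HU.
Qed.

(** The limit [e -> oo] of Gauss's sum for the basic series
    [2phi1 (a, e; a b; p, b / e)].  Multiplying [b] by [p] changes the sum by
    the factor [(1 - a b) / (1 - b)], and the sum tends to 1 along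
    [b, b p, b p^2, ...], so the infinite product accumulates. *)
Lemma gauss_sum (a b p : C) :
  (Cmod p < 1)%R -> (Cmod b < 1)%R -> (Cmod (a * b) < 1)%R ->
  Cseries (gauss_term a b p) (qpoch_inf b p / qpoch_inf (a * b) p).
Proof.
intros hp hb hab. pose proof (Cmod_ge_0 b) as Hb0. pose proof (Cmod_ge_0 p) as Hp0.
destruct (gauss_term_bound a p (Cmod (a * b)) hp hab) as [K [HK HKb]].
assert (Hbm : forall m, (Cmod (b * p ^ m) <= Cmod b)%R).
{ intros m. rewrite Cmod_mult. apply Rmult_le_l; [exact Hb0|].
  apply Cmod_pow_le_1. lra. }
assert (Habm : forall m, (Cmod (a * (b * p ^ m)) <= Cmod (a * b))%R).
{ intros m. rewrite !Cmod_mult. apply Rmult_le_compat_l; [apply Cmod_ge_0|].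
  rewrite <- Cmod_mult. apply Hbm. }
assert (Hex : forall m, exists F, Cseries (gauss_term a (b * p ^ m) p) F).
{ intros m. apply (Cseries_ex_of_geom _ K (Cmod (b * p ^ m))).
  - split; [apply Cmod_ge_0|]. specialize (Hbm m). lra.
  - intros n. apply HKb, Habm. }
destruct (Hex O) as [F HF]. cbn [Cpow] in HF. rewrite Cmult_1_r in HF.
assert (Hm : forall m Fm, Cseries (gauss_term a (b * p ^ m) p) Fm ->
               qpoch (a * b) p m * F = qpoch b p m * Fm).
{ induction m as [|m IH]; intros Fm HFm.
  - cbn [Cpow qpoch] in *. rewrite Cmult_1_r in HFm.
    rewrite (Cseries_unique _ _ _ HF HFm). reflexivity.
  - destruct (Hex m) as [G HG]. specialize (IH G HG). cbn [qpoch].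
    assert (S1 : (1 - b * p ^ m) * Fm = (1 - a * (b * p ^ m)) * G).
    { apply (gauss_sum_shift a (b * p ^ m) p G Fm hp); try assumption.
      - specialize (Hbm m). lra.
      - specialize (Habm m). lra.
      - replace (b * p ^ m * p) with (b * p ^ S m) by (rewrite Cpow_S; ring).
        exact HFm. }
    rewrite <- !Cmult_assoc, S1.
    replace (a * (b * p ^ m)) with (a * b * p ^ m) by ring.
    replace (qpoch (a * b) p m * ((1 - a * b * p ^ m) * F))
      with ((1 - a * b * p ^ m) * (qpoch (a * b) p m * F)) by ring.
    rewrite IH. ring. }
assert (Hone : forall m Fm, Cseries (gauss_term a (b * p ^ m) p) Fm ->
                 (Cmod (Fm - 1) <= K / (1 - Cmod b) * Cmod p ^ m)%R).
{ intros m Fm HFm. apply Cseries_tail in HFm.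
  replace (Fm - gauss_term a (b * p ^ m) p 0) with (Fm - 1) in HFm
    by (unfold gauss_term; cbn; field; apply C1_nz).
  replace (K / (1 - Cmod b) * Cmod p ^ m)%R
    with (K * Cmod p ^ m / (1 - Cmod b))%R by (field; lra).
  eapply Cseries_bound_geom; [| |exact HFm]; [lra|].
  intros n. eapply Rle_trans; [apply HKb, Habm|].
  rewrite Rmult_assoc. apply Rmult_le_compat_l; [exact HK|].
  cbn [pow]. apply Rmult_le_compat.
  - apply Cmod_ge_0.
  - apply pow_le, Cmod_ge_0.
  - rewrite Cmod_mult, Cmod_pow, Rmult_comm.
    apply Rmult_le_l; [apply pow_le; exact Hp0 | lra].
  - apply pow_incr. split; [apply Cmod_ge_0 | apply Hbm]. }
assert (HE : qpoch_inf (a * b) p * F = qpoch_inf b p * 1).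
{ apply (Clim_unique (fun m => qpoch (a * b) p m * F)).
  - apply Clim_mult; [apply qpoch_Clim, hp | apply Clim_const].
  - (* [qpoch (a * b) p m * F - qpoch b p m] is [qpoch b p m] times the distance
       to 1 of the m-th shifted sum. *)
    assert (Hd : Clim (fun m => qpoch (a * b) p m * F - qpoch b p m) 0).
    { apply (Clim_of_bound _ _ (fun m => exp (Cmod b / (1 - Cmod p))
               * (K / (1 - Cmod b)) * Cmod p ^ m)%R).
      - intros m. destruct (Hex m) as [G HG]. rewrite (Hm m G HG).
        replace (qpoch b p m * G - qpoch b p m - 0) with (qpoch b p m * (G - 1)) by ring.
        rewrite Cmod_mult, Rmult_assoc.
        apply Rmult_le_compat; try apply Cmod_ge_0.
        + apply qpoch_upper, hp.
        + apply Hone, HG.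
      - apply is_lim_seq_Cmod_pow, hp. }
    rewrite Cmult_1_r. pose proof (qpoch_Clim b p hp) as Hq.
    apply (Clim_of_bound _ _ (fun m => Cmod (qpoch (a * b) p m * F - qpoch b p m - 0)
             + Cmod (qpoch b p m - qpoch_inf b p))%R).
    + intros m. eapply Rle_trans; [|apply Cmod_triangle]. right. f_equal. ring.
    + replace (Finite 0) with (Finite (0 + 0)) by (f_equal; ring).
      apply is_lim_seq_plus'; [exact Hd | exact Hq]. }
assert (HN : qpoch_inf (a * b) p <> 0) by (apply qpoch_inf_neq_0; assumption).
replace (qpoch_inf b p / qpoch_inf (a * b) p) with F; [exact HF|].
apply (f_equal (fun z => z / qpoch_inf (a * b) p)) in HE.
transitivity (qpoch_inf (a * b) p * F / qpoch_inf (a * b) p).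
- field. exact HN.
- rewrite HE. field. exact HN.
Qed.

(** * Adding two consecutive tails *)

(** The summand of the theorem.  For [l = n = 0] the ratio
    [(1 - q^(2l)) / (1 - q^(2n+2l))] is read as 1, which turns the series for
    [l = 0] into the single term 1 and lets the induction start there. *)
Definition tail_term (q : C) (l n : nat) : C :=
  qpoch (- q) (q ^ 2) (n + l) * q ^ (2 * l * n + n ^ 2 + 2 * l ^ 2 - l)
  * match (n + l)%nat with
    | O => 1
    | S _ => (1 - q ^ (2 * l)) / (1 - q ^ (2 * n + 2 * l))
    end
  / (qpoch (q ^ 2) (q ^ 2) n * qpoch (q ^ 2) (q ^ 2) (n + 2 * l)).

(** The sum of the tail terms [(l, n)] and [(l + 1, n - 1)], which share the index
    [N = n + l], after cancelling [1 - q^(2N)]. *)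
Definition pair_term (q : C) (l n : nat) : C :=
  q ^ (2 * l ^ 2 - l) * (1 - q ^ (4 * l + 2))
  * (qpoch (- q) (q ^ 2) (n + l) * q ^ (n ^ 2 + 2 * l * n)
     / (qpoch (q ^ 2) (q ^ 2) n * qpoch (q ^ 2) (q ^ 2) (n + 2 * l + 1))).

Lemma Cmod_sqr_lt_1 (q : C) : (Cmod q < 1)%R -> (Cmod (q ^ 2) < 1)%R.
Proof.
intros hq. rewrite Cpow_S, Cpow_1_r. apply Cmod_mult_lt_1; lra.
Qed.

Lemma one_minus_pow_neq_0 (q : C) (n : nat) : (Cmod q < 1)%R -> 1 - q ^ S n <> 0.
Proof.
intros hq. rewrite Cpow_S. apply one_minus_neq_0, Cmod_mult_lt_1; [exact hq|].
apply Cmod_pow_le_1. lra.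
Qed.

Lemma qpoch_sqr_neq_0 (q : C) (n : nat) :
  (Cmod q < 1)%R -> qpoch (q ^ 2) (q ^ 2) n <> 0.
Proof. intros hq. apply qpoch_neq_0; now apply Cmod_sqr_lt_1. Qed.

Lemma pair_term_0 (q : C) (l : nat) : (Cmod q < 1)%R ->
  pair_term q l 0 = tail_term q l 0.
Proof.
intros hq. unfold pair_term, tail_term. cbn [Nat.add].
rewrite Nat.add_1_r. cbn [qpoch].
replace (0 ^ 2 + 2 * l * 0)%nat with O by (simpl; lia).
replace (2 * l * 0 + 0 ^ 2 + 2 * l ^ 2 - l)%nat with (2 * l ^ 2 - l)%nat by (simpl; lia).
rewrite <- !Cpow_mult_r, <- Cpow_add_r.
replace (2 + 2 * (2 * l))%nat with (S (4 * l + 1)) by lia.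
replace (4 * l + 2)%nat with (S (4 * l + 1)) by lia.
pose proof (one_minus_pow_neq_0 q (4 * l + 1) hq) as N1.
pose proof (qpoch_sqr_neq_0 q (2 * l) hq) as N2.
destruct l as [|l].
- cbn in *. rewrite Cmult_1_r in *. field. exact N1.
- replace (2 * 0 + 2 * S l)%nat with (S (2 * l + 1)) by lia.
  replace (2 * S l)%nat with (S (2 * l + 1)) in * by lia.
  pose proof (one_minus_pow_neq_0 q (2 * l + 1) hq) as N3.
  cbn [Cpow]. field. repeat split; assumption.
Qed.

(** With [a = q^(2l)], [x = q^(2N)], [p = q^2], where [N = n + l + 1] is the
    value of the shifted index in both tail terms, this is
    [(1-a)(1-apx) + a(1-ap)(1-x/a) = (1-a^2 p)(1-x)]; the last factor cancels the
    denominator [1 - q^(2N)]. *)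
Lemma pair_term_S (q : C) (l n : nat) : (Cmod q < 1)%R ->
  pair_term q l (S n) = tail_term q l (S n) + tail_term q (S l) n.
Proof.
intros hq. unfold pair_term, tail_term.
replace (n + S l)%nat with (S (n + l)) by lia.
replace (S n + l)%nat with (S (n + l)) by lia.
replace (S n + 2 * l + 1)%nat with (S (S (n + 2 * l))) by lia.
replace (n + 2 * S l)%nat with (S (S (n + 2 * l))) by lia.
replace (S n + 2 * l)%nat with (S (n + 2 * l)) by lia.
replace (2 * S n + 2 * l)%nat with (S (2 * n + 2 * l + 1)) by lia.
replace (2 * n + 2 * S l)%nat with (S (2 * n + 2 * l + 1)) by lia.
assert (Hl : (l <= 2 * l ^ 2)%nat) by (simpl; nia).
set (s := (2 * l ^ 2 - l)%nat).
set (e := (S n ^ 2 + 2 * l * S n)%nat).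
replace (2 * l * S n + S n ^ 2 + 2 * l ^ 2 - l)%nat with (s + e)%nat by (unfold s, e; lia).
replace (2 * S l * n + n ^ 2 + 2 * S l ^ 2 - S l)%nat with (s + e + 2 * l)%nat
  by (unfold s, e; simpl in *; nia).
cbn [qpoch].
pose proof (qpoch_sqr_neq_0 q n hq) as N1.
pose proof (qpoch_sqr_neq_0 q (n + 2 * l) hq) as N2.
pose proof (one_minus_pow_neq_0 q (2 * n + 1) hq) as N3.
pose proof (one_minus_pow_neq_0 q (2 * (n + 2 * l) + 1) hq) as N4.
pose proof (one_minus_pow_neq_0 q (2 * (n + 2 * l) + 3) hq) as N5.
pose proof (one_minus_pow_neq_0 q (2 * n + 2 * l + 1) hq) as N6.
rewrite <- !Cpow_mult_r, <- !Cpow_add_r.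
replace (2 + 2 * n)%nat with (S (2 * n + 1)) by lia.
replace (2 + 2 * (n + 2 * l))%nat with (S (2 * (n + 2 * l) + 1)) by lia.
replace (2 + 2 * S (n + 2 * l))%nat with (S (2 * (n + 2 * l) + 3)) by lia.
assert (K : (1 - q ^ (2 * l)) * (1 - q ^ S (2 * (n + 2 * l) + 3))
            + q ^ (2 * l) * (1 - q ^ (2 * S l)) * (1 - q ^ S (2 * n + 1))
            = (1 - q ^ (4 * l + 2)) * (1 - q ^ S (2 * n + 2 * l + 1))).
{ replace (S (2 * (n + 2 * l) + 3)) with (2 + (2 + (2 * n + (2 * l + 2 * l))))%nat by lia.
  replace (2 * S l)%nat with (2 + 2 * l)%nat by lia.
  replace (S (2 * n + 1)) with (2 + 2 * n)%nat by lia.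
  replace (4 * l + 2)%nat with (2 + (2 * l + 2 * l))%nat by lia.
  replace (S (2 * n + 2 * l + 1)) with (2 + (2 * n + 2 * l))%nat by lia.
  rewrite !Cpow_add_r. ring. }
rewrite (Cpow_add_r q (s + e) (2 * l)), (Cpow_add_r q s e).
set (d3 := 1 - q ^ S (2 * n + 1)) in *.
set (d4 := 1 - q ^ S (2 * (n + 2 * l) + 1)) in *.
set (d5 := 1 - q ^ S (2 * (n + 2 * l) + 3)) in *.
set (d6 := 1 - q ^ S (2 * n + 2 * l + 1)) in *.
set (k := 1 - q ^ (4 * l + 2)) in *.
assert (Ek : k = ((1 - q ^ (2 * l)) * d5 + q ^ (2 * l) * (1 - q ^ (2 * S l)) * d3) / d6).
{ rewrite K. field. exact N6. }
rewrite Ek. field. repeat split; assumption.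
Qed.

(** By [1 = (1 - q^(2n+4l+2)) + q^(2n+4l+2)] each term splits into two terms
    of limiting q-Gauss sums, with parameters [a = b = - q^(2l+1)] and with [b]
    replaced by [b q^2]; this is what produces the factor
    [1 - b + b^2 = (1 - q^(6l+3)) / (1 - q^(2l+1))]. *)
Lemma pair_sum (q : C) (l : nat) : (Cmod q < 1)%R ->
  Cseries (pair_term q l)
    (qpoch_inf (- q) (q ^ 2) / qpoch_inf (q ^ 2) (q ^ 2)
     * (q ^ (2 * l ^ 2 - l) * (1 - q ^ (6 * l + 3)))).
Proof.
intros hq. pose proof (Cmod_sqr_lt_1 q hq) as hp.
assert (Ep : forall k, q ^ (2 * k) = (q ^ 2) ^ k) by (intros k; apply Cpow_mult_r).
set (s := q ^ (2 * l ^ 2 - l)).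
pose (a := - q * (q ^ 2) ^ l). pose (c := q ^ 2 * (q ^ 2) ^ (2 * l)).
assert (Ea : a = - q ^ (2 * l + 1)).
{ unfold a. rewrite Cpow_add_r, Cpow_1_r, Ep. ring. }
assert (Eaa : a * a = c).
{ unfold a, c. replace (2 * l)%nat with (l + l)%nat by lia. rewrite Cpow_add_r. ring. }
assert (Ec : q ^ (4 * l + 2) = c).
{ unfold c. rewrite <- Ep, <- Cpow_add_r. f_equal. lia. }
assert (E3 : q ^ (6 * l + 3) = - (a * c)).
{ unfold a, c. rewrite <- !Ep.
  replace (6 * l + 3)%nat with (1 + 2 * l + (2 + 2 * (2 * l)))%nat by lia.
  rewrite !Cpow_add_r, Cpow_1_r. ring. }
assert (ha : (Cmod a < 1)%R).
{ rewrite Ea, Cmod_opp, Nat.add_1_r, Cpow_S. apply Cmod_mult_lt_1; [exact hq|].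
  apply Cmod_pow_le_1. lra. }
assert (hc : (Cmod c < 1)%R) by (rewrite <- Eaa; apply Cmod_mult_lt_1; lra).
assert (hap : (Cmod (a * q ^ 2) < 1)%R) by (apply Cmod_mult_lt_1; lra).
assert (hcp : (Cmod (c * q ^ 2) < 1)%R) by (apply Cmod_mult_lt_1; lra).
assert (Ecp : a * (a * q ^ 2) = c * q ^ 2) by (rewrite <- Eaa; ring).
assert (G1 := gauss_sum a a (q ^ 2) hp ha). rewrite Eaa in G1. specialize (G1 hc).
assert (G2 := gauss_sum a (a * q ^ 2) (q ^ 2) hp hap). rewrite Ecp in G2.
specialize (G2 hcp).
set (A := qpoch (- q) (q ^ 2) l). set (D := qpoch (q ^ 2) (q ^ 2) (2 * l)).
assert (ND : D <> 0) by (apply qpoch_sqr_neq_0, hq).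
assert (N1 : 1 - c <> 0) by (apply one_minus_neq_0, hc).
replace (qpoch_inf (- q) (q ^ 2) / qpoch_inf (q ^ 2) (q ^ 2) * (s * (1 - q ^ (6 * l + 3))))
  with (s * (1 - c) * A / D * (qpoch_inf a (q ^ 2) / qpoch_inf c (q ^ 2))
        + s * A * c / D * (qpoch_inf (a * q ^ 2) (q ^ 2) / qpoch_inf (c * q ^ 2) (q ^ 2))).
- apply (Cseries_ext (fun n =>
    s * (1 - c) * A / D * gauss_term a a (q ^ 2) n
    + s * A * c / D * gauss_term a (a * q ^ 2) (q ^ 2) n));
    [|apply Cseries_plus; apply Cseries_scal; assumption].
  intros n. unfold gauss_term, pair_term. fold s. rewrite Eaa, Ecp, Ec.
  rewrite (Nat.add_comm n l), qpoch_add. fold A a.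
  replace (n + 2 * l + 1)%nat with (2 * l + S n)%nat by lia.
  rewrite qpoch_add. fold D c.
  assert (Ew : q ^ (n ^ 2 + 2 * l * n) = (- a) ^ n * (q ^ 2) ^ (n * (n - 1) / 2)).
  { rewrite Ea, <- Ep. replace (- - q ^ (2 * l + 1)) with (q ^ (2 * l + 1)) by ring.
    rewrite <- Cpow_mult_r, <- Cpow_add_r. f_equal.
    pose proof (triangular_double n). lia. }
  rewrite Ew.
  replace ((- (a * q ^ 2)) ^ n) with ((- a) ^ n * (q ^ 2) ^ n)
    by (rewrite <- Cpow_mult_l; f_equal; ring).
  assert (N2 : qpoch c (q ^ 2) n <> 0) by (apply qpoch_neq_0; assumption).
  assert (N3 : qpoch (q ^ 2) (q ^ 2) n <> 0) by (apply qpoch_sqr_neq_0, hq).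
  assert (N4 : 1 - c * (q ^ 2) ^ n <> 0).
  { apply one_minus_neq_0, Cmod_mult_lt_1; [exact hc|]. apply Cmod_pow_le_1. lra. }
  assert (Eh : qpoch (c * q ^ 2) (q ^ 2) n
               = qpoch c (q ^ 2) n * (1 - c * (q ^ 2) ^ n) / (1 - c)).
  { change (qpoch c (q ^ 2) n * (1 - c * (q ^ 2) ^ n)) with (qpoch c (q ^ 2) (S n)).
    rewrite qpoch_head. field. exact N1. }
  rewrite Eh. cbn [qpoch].
  generalize dependent ((q ^ 2) ^ n). intros x N4 Eh.
  generalize dependent (qpoch c (q ^ 2) n). intros y N2 Eh.
  field. repeat split; assumption.
- rewrite E3.
  rewrite (qpoch_inf_split (- q) (q ^ 2) l hp). fold A a.
  rewrite (qpoch_inf_split (q ^ 2) (q ^ 2) (2 * l) hp). fold D c.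
  rewrite (qpoch_inf_split a (q ^ 2) 1 hp), (qpoch_inf_split c (q ^ 2) 1 hp).
  rewrite Cpow_1_r.
  assert (N2 : qpoch_inf (c * q ^ 2) (q ^ 2) <> 0) by (apply qpoch_inf_neq_0; assumption).
  cbn [qpoch]. change ((q ^ 2) ^ 0) with (RtoC 1). rewrite !Cmult_1_r, !Cmult_1_l.
  clear G1 G2. generalize dependent (qpoch_inf (c * q ^ 2) (q ^ 2)). intros y N2.
  generalize (qpoch_inf (a * q ^ 2) (q ^ 2)). intros z.
  clearbody c. subst c. clear -ND N1 N2.
  clearbody a A D s. field. repeat split; assumption.
Qed.

(** * Truncated theta series *)

Definition theta_trunc (q : C) (l : nat) : C :=
  @sum_n_m C_AbelianMonoid
    (fun i : nat =>
       let j := (Z.of_nat i - Z.of_nat l)%Z in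
       Cpowz (-1) j * Cpowz q (2 * j ^ 2 + j)) 1 (2 * l).

Lemma Cpowz_of_nat (z : C) (n : nat) : Cpowz z (Z.of_nat n) = z ^ n.
Proof.
destruct n as [|n]; [reflexivity|].
cbn [Z.of_nat Cpowz]. now rewrite SuccNat2Pos.id_succ.
Qed.

Lemma Cpow_opp1_sqr (n : nat) : (-1) ^ n * (-1) ^ n = 1.
Proof.
rewrite <- Cpow_mult_l. replace (-1 * -1) with (RtoC 1) by ring. apply Cpow_1_l.
Qed.

Lemma Cpowz_opp1_opp (n : nat) : Cpowz (-1) (- Z.of_nat n) = (-1) ^ n.
Proof.
destruct n as [|n]; [reflexivity|].
cbn [Z.of_nat Z.opp Cpowz]. rewrite SuccNat2Pos.id_succ.
pose proof (Cpow_opp1_sqr (S n)) as H.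
assert (N : (-1) ^ S n <> 0).
{ intros E. rewrite E in H. apply C1_nz. rewrite <- H. ring. }
transitivity ((-1) ^ S n * (-1) ^ S n / (-1) ^ S n).
- rewrite H. field. exact N.
- field. exact N.
Qed.

Lemma theta_trunc_S (q : C) (l : nat) :
  theta_trunc q (S l)
  = theta_trunc q l + (-1) ^ l * (q ^ (2 * l ^ 2 - l) * (1 - q ^ (6 * l + 3))).
Proof.
unfold theta_trunc. replace (2 * S l)%nat with (S (S (2 * l))) by lia.
rewrite sum_Sn_m, sum_n_Sm, <- sum_n_m_S by lia.
rewrite (sum_n_m_ext _ (fun i : nat =>
  let j := (Z.of_nat i - Z.of_nat l)%Z in Cpowz (-1) j * Cpowz q (2 * j ^ 2 + j))).
2:{ intros i. replace (Z.of_nat (S i) - Z.of_nat (S l))%Z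
      with (Z.of_nat i - Z.of_nat l)%Z by lia. reflexivity. }
cbv zeta.
assert (Hl : (l <= 2 * l ^ 2)%nat) by (simpl; nia).
replace (Z.of_nat 1 - Z.of_nat (S l))%Z with (- Z.of_nat l)%Z by lia.
replace (Z.of_nat (S (S (2 * l))) - Z.of_nat (S l))%Z with (Z.of_nat (S l)) by lia.
replace (2 * (- Z.of_nat l) ^ 2 + - Z.of_nat l)%Z with (Z.of_nat (2 * l ^ 2 - l))
  by (rewrite Nat2Z.inj_sub by exact Hl; simpl Nat.pow; lia).
replace (2 * Z.of_nat (S l) ^ 2 + Z.of_nat (S l))%Z
  with (Z.of_nat ((2 * l ^ 2 - l) + (6 * l + 3)))
  by (rewrite Nat2Z.inj_add, Nat2Z.inj_sub by exact Hl; simpl Nat.pow; lia).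
rewrite Cpowz_opp1_opp, !Cpowz_of_nat, (Cpow_add_r q), (Cpow_S (-1)).
change (@plus C_AbelianMonoid) with Cplus.
match goal with |- ?x = ?y => change (@eq C x y) end. ring.
Qed.

(** For [l = 0] both sides are 0; adding [pair_sum] at each step moves the two
    outer theta terms across. *)
Lemma theta_trunc_tail (q : C) (l : nat) : (Cmod q < 1)%R ->
  exists S, Cseries (tail_term q l) S /\
    qpoch_inf (- q) (q ^ 2) / qpoch_inf (q ^ 2) (q ^ 2) * theta_trunc q l
    = 1 - (-1) ^ l * S.
Proof.
intros hq. set (Q := qpoch_inf (- q) (q ^ 2) / qpoch_inf (q ^ 2) (q ^ 2)).
induction l as [|l [T [HT IH]]].
- exists 1. split.
  + apply Cseries_cons.
    replace (1 - tail_term q 0 0) with (0 * (Q * (q ^ (2 * 0 ^ 2 - 0) * (1 - q ^ (6 * 0 + 3)))))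
      by (unfold tail_term; cbn; field; apply C1_nz).
    (* The zero series, as a multiple of a series known to converge. *)
    apply (Cseries_ext (fun n => 0 * pair_term q 0 n)).
    * intros n. unfold tail_term. replace (q ^ (2 * 0)) with (RtoC 1) by reflexivity.
      cbn [Nat.add]. unfold Cdiv. ring.
    * apply Cseries_scal, pair_sum, hq.
  + unfold theta_trunc. rewrite sum_n_m_zero by lia.
    change (@zero C_AbelianMonoid) with (RtoC 0). cbn [Cpow]. ring.
- pose proof (pair_sum q l hq) as HV. fold Q in HV.
  set (w := q ^ (2 * l ^ 2 - l) * (1 - q ^ (6 * l + 3))) in *.
  exists (Q * w - T). split.
  + apply (Cseries_ext (fun n => pair_term q l (S n) + (- (1)) * tail_term q l (S n))).
    { intros n. rewrite pair_term_S by exact hq. ring. }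
    replace (Q * w - T)
      with ((Q * w - pair_term q l 0) + (- (1)) * (T - tail_term q l 0))
      by (rewrite pair_term_0 by exact hq; ring).
    apply Cseries_plus; [|apply Cseries_scal]; apply Cseries_tail; assumption.
  + rewrite theta_trunc_S. fold w. rewrite Cmult_plus_distr_l, IH, Cpow_S. ring.
Qed.

Theorem theorem1p4 (l : nat) (q : C) (hl : (1 <= l)%nat) (hq : (Cmod q < 1)%R) :
  exists S : C,
    @is_series C_AbsRing C_NormedModule
      (fun n : nat =>
         qpoch (- q) (q ^ 2) (n + l)
         * q ^ (2 * l * n + n ^ 2 + 2 * l ^ 2 - l)
         * (1 - q ^ (2 * l))
         / (qpoch (q ^ 2) (q ^ 2) n * qpoch (q ^ 2) (q ^ 2) (n + 2 * l)
            * (1 - q ^ (2 * n + 2 * l)))) S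
    /\ qpoch_inf (- q) (q ^ 2) / qpoch_inf (q ^ 2) (q ^ 2)
       * @sum_n_m C_AbelianMonoid
           (fun i : nat =>
              let j := (Z.of_nat i - Z.of_nat l)%Z in
              Cpowz (-1) j * Cpowz q (2 * j ^ 2 + j)) 1 (2 * l)
       = 1 + (-1) ^ (l - 1) * S.
Proof.
destruct (theta_trunc_tail q l hq) as [T [HT HE]]. exists T. split.
- apply (Cseries_ext (tail_term q l)); [|exact HT].
  intros n. unfold tail_term. destruct l as [|l]; [lia|].
  rewrite (Nat.add_succ_r n l) at 2. cbn iota.
  pose proof (qpoch_sqr_neq_0 q n hq) as N1.
  pose proof (qpoch_sqr_neq_0 q (n + 2 * S l) hq) as N2.
  pose proof (one_minus_pow_neq_0 q (2 * n + 2 * l + 1) hq) as N3.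
  replace (2 * n + 2 * S l)%nat
    with (S (2 * n + 2 * l + 1)) by lia.
  field. repeat split; assumption.
- destruct l as [|l]; [lia|]. etransitivity; [exact HE|].
  rewrite Cpow_S. replace (S l - 1)%nat with l by lia. ring.
Qed.
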